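(* Let $n>6$. If there is a minimal pancyclic graph on $n$ vertices with an arc of length at least $(n-1)/2$, then $m(n-1)<m(n)$. If there is a minimal pancyclic graph on $n$ vertices with an arc of length at least $(n+2)/3$, then $m(n-1)\leq m(n)$.
   Context: All graphs are finite and simple. A graph on $n\geq 3$ vertices is pancyclic if it contains a cycle of length $\ell$ for every integer $\ell$ with $3\le \ell\le n$. For $n\ge 3$, $m(n)$ denotes the minimum number of edges among all pancyclic graphs on $n$ vertices. A minimal pancyclic graph on $n$ vertices is a pancyclic graph on $n$ vertices with exactly $m(n)$ edges. A pancyclic graph $G$ is considered together with a Hamiltonian cycle $H$; an arc is a maximal path contained in $H$ such that none of its interior vertices has degree greater than $2$ in $G$ (trivial paths consisting of a single vertex are also allowed as arcs). The length of an arc is its number of edges. *)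

(* Defs.v *)
From HB Require Import structures.
From mathcomp Require Import all_boot.

Set Implicit Arguments.
Unset Strict Implicit.
Unset Printing Implicit Defensive.

(* Finite simple graphs on the vertex set 'I_n, given by a set of 2-element
   subsets of 'I_n. *)
Record sgraph (n : nat) := SGraph {
  edges : {set {set 'I_n}};
  _ : [forall e in edges, #|e| == 2] }.

HB.instance Definition _ n := [isSub for @edges n].
HB.instance Definition _ n := [Countable of sgraph n by <:].
HB.instance Definition _ n := [Finite of sgraph n by <:].

Section Graphs.
Variable n : nat.
Implicit Types (G : sgraph n) (x y : 'I_n) (H p q c : seq 'I_n).

Definition adj G : rel 'I_n := fun x y => [set x; y] \in edges G.

Definition degree G x : nat := #|[set e in edges G | x \in e]|.

(* Only meaningful for 3 <= l: [ucycleb] also accepts the degenerate closed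
   walk x, y, x along a single edge. *)
Definition has_cycle G (l : nat) : bool :=
  [exists c : l.-tuple 'I_n, ucycleb (adj G) c].

Definition pancyclic G : bool :=
  (3 <= n) && [forall l : 'I_n.+1, (3 <= l) ==> has_cycle G l].

Lemma complete_edgesP :
  [forall e in [set e : {set 'I_n} | #|e| == 2], #|e| == 2].
Proof. by apply/forall_inP => e; rewrite inE. Qed.

Definition complete : sgraph n := SGraph complete_edgesP.

Lemma complete_pancyclic : 3 <= n -> pancyclic complete.
Proof.
move=> n_ge3; rewrite /pancyclic n_ge3; apply/forallP => l; apply/implyP => l_ge3.
have sz : size (take l (enum 'I_n)) == l.
  by rewrite size_takel // size_enum_ord -ltnS.
apply/existsP; exists (Tuple sz) => /=; rewrite /ucycleb take_uniq ?enum_uniq //.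
have := take_uniq l (enum_uniq 'I_n); move: sz; rewrite andbT.
case: (take l _) => [/eqP sz|x s sz]; first by rewrite -sz in l_ge3.
move=> Us; have adjE u v : u != v -> adj complete u v.
  by move=> uv; rewrite /adj inE cards2 uv.
have Pw : forall u t, uniq (u :: t) -> path (adj complete) u t.
  move=> u t; elim: t u => //= v t IH u /andP[].
  by rewrite inE negb_or => /andP[uv _] /IH ->; rewrite adjE.
rewrite /= rcons_path Pw //= adjE //.
case: s Us sz => [|y s] /= Us sz; first by rewrite -(eqP sz) in l_ge3.
by case/andP: Us => xs _; apply: contraNneq xs => <-; apply: mem_last.
Qed.

(* A Hamiltonian cycle, given as a cyclic sequence of vertices. *)
Definition hamiltonian G H : bool :=
  [&& 3 <= n, ucycleb (adj G) H & size H == n].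

Definition hadj H : rel 'I_n := fun x y => (y == next H x) || (x == next H y).

Definition path_in H p : bool :=
  if p is x :: s then path (hadj H) x s && uniq p else false.

Definition interior p : seq 'I_n :=
  if p is x :: s then behead (belast x s) else [::].

Definition thin_path G H p : bool :=
  path_in H p && all (fun v => ~~ (2 < degree G v)) (interior p).

(* Sequences represent paths up to reversal; since thin paths are closed under
   reversal, maximality for [infix] is maximality for inclusion of subgraphs.
   One-vertex paths count as arcs even when they are not maximal. *)
Definition is_arc G H p : Prop :=
  thin_path G H p /\
  (size p = 1 \/ forall q, thin_path G H q -> infix p q -> q = p).

Definition path_length p : nat := (size p).-1.

End Graphs.

(* The minimum is attained by a pancyclic graph as soon as 3 <= n, thanks to
   [complete_pancyclic]; the value for n < 3 is junk. *)
Definition m (n : nat) : nat :=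
  #|edges [arg min_(G < complete n | pancyclic G) #|edges G|]|.

Definition minimal_pancyclic (n : nat) (G : sgraph n) : Prop :=
  pancyclic G /\ #|edges G| = m n.

Lemma m_attained (n : nat) : 3 <= n -> exists G : sgraph n, minimal_pancyclic G.
Proof.
move=> n_ge3; rewrite /minimal_pancyclic /m.
by case: arg_minnP => [|G pG _]; [exact: complete_pancyclic | exists G].
Qed.

Lemma m_min (n : nat) (G : sgraph n) : pancyclic G -> m n <= #|edges G|.
Proof.
move=> pG; have [n_ge3 _] := andP pG; rewrite /m.
by case: arg_minnP => [|G' _ minG']; [exact: complete_pancyclic | exact: minG'].
Qed.

(* Main.v *)
Require Import Defs.
From mathcomp Require Import all_boot zify.

(** Let L be the length of the arc, u and v its ends, w the vertex that follows
    u on the arc and x the one after w; here L >= 3.  Interior vertices of the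
    arc have degree 2, so every cycle either contains the whole arc, and then
    has length at least L + 1 ([cycle_along_arc]), or avoids its interior, and
    then has length at most n - L + 1 ([cycle_off_arc_size]).

    Contract the edge uw, that is, delete w and add the edge ux; this costs one
    edge.  Cycles that avoid the arc survive, and cycles that contain it lose
    one from their length.  So in the contracted graph the lengths l <= L come
    from l-cycles, which avoid the arc, and the lengths l >= n - L + 1 come from
    (l+1)-cycles, which contain it.  What may be missing are the lengths between
    L + 1 and n - L.  If u and v are adjacent, replacing the arc by the edge uv
    in a cycle of length l + L - 1 gives an l-cycle; such a cycle contains the
    arc because l + L - 1 >= 2L > n - L + 1 as soon as 3L >= n + 2.

    Adding the edge uv therefore proves the second claim, since the total number
    of edges does not increase.  For the first claim, the only possibly missing
    length is L + 1 = n - L.  An (L+1)-cycle of the original graph either avoids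
    the arc, and survives, or is the arc closed by the edge uv, which is then
    already there: no edge has to be added.  [m_pred_arc] treats both claims
    together. *)

Set Implicit Arguments.
Unset Strict Implicit.
Unset Printing Implicit Defensive.

(** * Cycles and vertices of degree two *)

Section CyclesAndDegrees.
Variable n : nat.
Implicit Types (G : sgraph n) (x y : 'I_n) (p c s : seq 'I_n).

(** Adjacency for a bare set of pairs, so that edges can be added to a graph
    without rebuilding the record; [adj G] is the case [F := edges G]. *)
Definition edge_rel (F : {set {set 'I_n}}) : rel 'I_n :=
  fun x y => [set x; y] \in F.

Lemma adj_sym G : symmetric (adj G).
Proof. by move=> x y; rewrite /adj setUC. Qed.

Lemma card_edge G e : e \in edges G -> #|e| = 2.
Proof. by case: G => E HE /= /(forall_inP HE)/eqP. Qed.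

Lemma pair_inj y : injective (fun z => [set y; z]).
Proof.
move=> a b /setP E; move: (E a) (E b); rewrite !inE !eqxx !orbT.
case: (a =P b) => // _; rewrite orbF => /esym/eqP-> /=.
by case: (b =P y) => [->|].
Qed.

Lemma card_neighbours_le G y (A : {set 'I_n}) :
  (forall a, a \in A -> adj G y a) -> #|A| <= degree G y.
Proof.
move=> adjA; rewrite -(card_imset (mem A) (@pair_inj y)); apply/subset_leq_card.
apply/subsetP => _ /imsetP[a /adjA ya ->].
by rewrite inE set21 andbT; exact: ya.
Qed.

Lemma degree2_neighbours G y a b d :
  ~~ (2 < degree G y) -> a != b -> adj G y a -> adj G y b -> adj G y d ->
  d = a \/ d = b.
Proof.
move=> dy ab ya yb yd; apply/pred2P/negPn/negP; rewrite negb_or => /andP[da db].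
move/negP: dy; apply; have <- : #|d |: [set a; b]| = 3.
  by rewrite cardsU1 !inE negb_or da db cards2 ab.
by apply: card_neighbours_le => z; rewrite !inE => /or3P[]/eqP->.
Qed.

Lemma next_neq_prev c y : uniq c -> 2 < size c -> y \in c ->
  next c y != prev c y.
Proof.
move=> Uc sc yc; apply/eqP => E.
have : next c (next c y) = y by rewrite E next_prev.
have [i c' Ec] := rot_to yc; rewrite -!(next_rot i Uc) Ec.
move: Uc sc; rewrite -(rot_uniq i) -(size_rot i) Ec.
case: c' {Ec E} => [|a [|b t]] //= /andP[+ _] _; rewrite !inE eqxx !negb_or.
case/and3P=> ya /negPf yb _; rewrite eq_sym (negPf ya) eqxx => /eqP.
by rewrite eq_sym yb.
Qed.

(** * Cycles that meet a path with interior vertices of degree two *)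

(** A cycle that enters such a path along its first edge has to follow it: at
    an interior vertex it cannot go back, and there is only one way on. *)
Lemma cycle_follows G c a b s :
  ucycle (adj G) c -> 2 < size c -> uniq [:: a, b & s] ->
  path (adj G) a (b :: s) -> all (fun v => ~~ (2 < degree G v)) (belast b s) ->
  a \in c -> next c a = b -> fpath (next c) a (b :: s).
Proof.
move=> /andP[Cc Uc] sc; elim: s a b => [|d s IH] a b Up Pp thin ac ab.
  by rewrite /= ab eqxx.
move: Up Pp thin => /andP[aNs Up] /andP[adj_ab Pp] /= /andP[deg_b thin].
have bc : b \in c by rewrite -ab mem_next.
have prev_b : prev c b = a by rewrite -ab prev_next.
have ad : a != d by move: aNs; rewrite !inE !negb_or => /and3P[].
have bd : next c b = d.
  have adj_ba : adj G b a by rewrite adj_sym.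
  have [next_b|//] :=
    degree2_neighbours deg_b ad adj_ba (andP Pp).1 (next_cycle Cc bc).
  by have := next_neq_prev Uc sc bc; rewrite next_b prev_b eqxx.
by rewrite /= ab eqxx; apply: IH.
Qed.

(** Read from [a] on, both the cycle and the path list the iterates of
    [next c], so the shorter one is a prefix of the other. *)
Lemma fpath_next_prefix (e : rel 'I_n) c a q :
  ucycle e c -> a \in c -> fpath (next c) a q -> uniq (a :: q) ->
  exists r, ucycle e ((a :: q) ++ r) /\ size ((a :: q) ++ r) = size c.
Proof.
move=> Uc ac Pq Uq; have [i c' Ec] := rot_to ac.
have sub : {subset a :: q <= rot i c}.
  move=> z; rewrite mem_rot inE => /predU1P[->//|].
  move: Pq => /fpathE->; case/trajectP => j _ ->.
  by elim: j => /= [|j IH]; rewrite mem_next.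
have := uniq_leq_size Uq sub; rewrite Ec /= ltnS => sz.
have Pc' : fpath (next c) a c'.
  have := cycle_next (ucycle_uniq Uc).
  by rewrite -(rot_cycle i) Ec /= rcons_path => /andP[].
have Eq : take (size q) c' = q.
  by rewrite (fpathE Pc') take_traject // -(fpathE Pq).
exists (drop (size q) c'); rewrite /= -{1 3}Eq !cat_take_drop -/(size (a :: c')).
by rewrite -Ec size_rot rot_ucycle.
Qed.

(** Both edges at an interior vertex belong to every cycle through it, so the
    cycle uses the first edge of the path, in one direction or the other. *)
Lemma cycle_along_arc G c a b d s :
  ucycle (adj G) c -> 2 < size c -> uniq [:: a, b, d & s] ->
  path (adj G) a [:: b, d & s] ->
  all (fun v => ~~ (2 < degree G v)) (belast b (d :: s)) -> b \in c ->
  exists r, ucycle (adj G) ([:: a, b, d & s] ++ r)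
    /\ size ([:: a, b, d & s] ++ r) = size c.
Proof.
move=> Ucyc sc Up Pp thin bc; have /andP[Cc Uc] := Ucyc.
have oriented c' : ucycle (adj G) c' -> size c' = size c -> a \in c' ->
    next c' a = b -> exists r, ucycle (adj G) ([:: a, b, d & s] ++ r)
      /\ size ([:: a, b, d & s] ++ r) = size c.
  move=> Uc' sc' ac' ab; rewrite -sc'; apply: fpath_next_prefix => //.
  by apply: (cycle_follows (G := G)) => //; rewrite sc'.
have ad : a != d by move: Up; rewrite /= !inE !negb_or => /andP[/and3P[]].
have [adj_ba adj_bd deg_b] : [/\ adj G b a, adj G b d & ~~ (2 < degree G b)].
  by move: Pp thin => /and3P[ab bd _] /andP[db _]; rewrite adj_sym.
have nb := degree2_neighbours deg_b ad adj_ba adj_bd.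
have [|next_b|next_b] := nb (next c b); first exact: next_cycle.
  apply: (oriented (rev c)); rewrite ?size_rev ?mem_rev -?next_b ?mem_next //.
    rewrite /ucycle rev_uniq Uc andbT rev_cycle.
    by rewrite (eq_cycle (e' := adj G)) // => x y; rewrite adj_sym.
  by rewrite next_rev // prev_next.
have [|prev_b|prev_b] := nb (prev c b).
- by rewrite adj_sym; exact: prev_cycle.
- by apply: (oriented c); rewrite -?prev_b ?mem_prev ?next_prev.
- by have := next_neq_prev Uc sc bc; rewrite next_b prev_b eqxx.
Qed.

(** Since [b] is not on the cycle, the next interior vertex has only one
    neighbour left that could be, while a cycle through it needs two; so the
    absence of [b] propagates along the path. *)
Lemma cycle_off_arc G c a b s :
  ucycle (adj G) c -> 2 < size c -> path (adj G) a (b :: s) ->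
  all (fun v => ~~ (2 < degree G v)) (belast b s) -> b \notin c ->
  ~~ has (mem c) (belast b s).
Proof.
move=> /andP[Cc Uc] sc; elim: s a b => [|d s IH] a b //= /andP[_ Pp].
case/andP=> deg_b thin bNc; rewrite negb_or bNc /=.
case: s => // e s in IH Pp thin *; apply: (IH b) => //.
apply: contra bNc => dc; have /andP[adj_bd _] := Pp.
have adj_db : adj G d b by rewrite adj_sym.
have adj_prev : adj G d (prev c d) by rewrite adj_sym; exact: prev_cycle.
have [] := degree2_neighbours (andP thin).1 (next_neq_prev Uc sc dc)
  (next_cycle Cc dc) adj_prev adj_db.
  by move->; rewrite mem_next.
by move->; rewrite mem_prev.
Qed.

Lemma cycle_off_arc_size G c a b d s :
  ucycle (adj G) c -> 2 < size c -> uniq [:: a, b, d & s] ->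
  path (adj G) a [:: b, d & s] ->
  all (fun v => ~~ (2 < degree G v)) (belast b (d :: s)) -> b \notin c ->
  size c + (size s).+1 <= n.
Proof.
move=> Ucyc sc Up Pp thin bNc; have off := cycle_off_arc Ucyc sc Pp thin bNc.
have Ui : uniq (belast b (d :: s)).
  move: Up; rewrite cons_uniq => /andP[_].
  by rewrite (lastI b) rcons_uniq => /andP[].
have Uall : uniq (c ++ belast b (d :: s)).
  by rewrite cat_uniq (ucycle_uniq Ucyc) off.
by rewrite -[(size s).+1](size_belast b (d :: s)) -size_cat -[leqRHS]card_ord
  -(card_uniqP Uall) max_card.
Qed.

Lemma path_in_adj G H p :
  hamiltonian G H -> path_in H p -> sorted (adj G) p && uniq p.
Proof.
case/and3P=> _ /andP[CH UH] /eqP sH; case: p => //= x s /andP[Pp ->].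
rewrite andbT; apply: sub_path Pp => y z.
have memH t : t \in H.
  have : #|H| = #|'I_n| by rewrite (card_uniqP UH) sH card_ord.
  by move/subset_cardP => /(_ (subset_predT _))->.
rewrite /hadj; case/orP=> /eqP->; last by rewrite adj_sym; exact: next_cycle.
exact: next_cycle.
Qed.

End CyclesAndDegrees.

(** * Deleting a vertex *)

(** Only the edges away from [w] are counted: [F] stands for a graph in which
    [w] has already been bypassed. *)
Lemma m_le_avoiding k (w : 'I_k.+1) (F : {set {set 'I_k.+1}}) :
  2 < k -> {in F, forall e : {set 'I_k.+1}, #|e| = 2} ->
  (forall l, 2 < l <= k -> exists c,
     [/\ ucycle (edge_rel F) c, w \notin c & size c = l]) ->
  m k <= #|[set e in F | w \notin e]|.
Proof.
move=> k_gt2 F2 cycF; pose E := [set e : {set 'I_k} | lift w @: e \in F].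
have E2 : [forall e in E, #|e| == 2].
  apply/forall_inP => e; rewrite inE => /F2.
  by rewrite card_imset; [move-> | exact: lift_inj].
have le_card : #|E| <= #|[set e in F | w \notin e]|.
  rewrite -(card_imset (mem E) (imset_inj (@lift_inj _ w))).
  apply/subset_leq_card/subsetP => _ /imsetP[e + ->]; rewrite !inE => -> /=.
  by apply/imsetP => -[i _ /eqP]; rewrite (negPf (neq_lift w i)).
apply: leq_trans le_card; apply: (m_min (G := SGraph E2)).
rewrite /pancyclic k_gt2; apply/forall_inP => l l_gt2.
have [|c [/andP[Cc Uc] wNc sc]] := cycF l; first by rewrite l_gt2 -ltnS ltn_ord.
have Ec : map (lift w) (pmap (unlift w) c) = c.
  elim: c wNc {Cc Uc sc} => //= z c IH; rewrite inE negb_or => /andP[wz /IH Ec].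
  by case: unliftP wz => [j ->|->] /=; rewrite ?Ec ?eqxx.
have sz : size (pmap (unlift w) c) == l by rewrite -(size_map (lift w)) Ec sc.
apply/existsP; exists (Tuple sz); rewrite /ucycleb /=.
apply/andP; split; last first.
  by rewrite -(map_inj_uniq (@lift_inj _ w)) Ec.
move: Cc; rewrite -{1}Ec cycle_map; apply: sub_cycle => i j /=.
by rewrite /adj /edge_rel inE imsetU1 imset_set1.
Qed.

Lemma card_bypass n (G : sgraph n) (A : {set {set 'I_n}}) u w x :
  adj G u w -> adj G w x -> u != x ->
  #|[set e in edges G :|: A | w \notin e]| + 2 <= #|edges G| + #|A|.
Proof.
move=> uw wx ux; have deg_w : 1 < degree G w.
  suff: #|[set u; x]| <= degree G w by rewrite cards2 ux.
  apply: card_neighbours_le => z.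
  by rewrite !inE => /pred2P[]->; rewrite // adj_sym.
rewrite -(cardsID [set e : {set 'I_n} | w \in e] (edges G)) -setIdE.
rewrite addnC -addnA leq_add //.
apply: leq_trans (leq_card_setU _ _); apply/subset_leq_card/subsetP => e.
by rewrite !inE => /andP[/orP[]->] ->; rewrite ?orbT.
Qed.

(** * Contracting an edge of the arc *)

(** The set [A] holds the added edges: the edge [ux] that bypasses [w], and
    possibly the edge joining the ends of the arc.  With n = k + 1 vertices and
    an arc of length L = size s + 2, the last two hypotheses say that 3L >= n + 2
    and that, when no edge is added between the ends, n <= 2L + 1, which leaves
    at most the length L + 1 in doubt. *)
Lemma m_pred_arc k (G : sgraph k.+1) (u w x : 'I_k.+1) s
    (A : {set {set 'I_k.+1}}) :
  2 < k -> pancyclic G -> uniq [:: u, w, x & s] ->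
  path (adj G) u [:: w, x & s] ->
  all (fun v => ~~ (2 < degree G v)) (belast w (x :: s)) ->
  {in A, forall e : {set 'I_k.+1}, #|e| = 2} -> [set u; x] \in A ->
  k + 3 <= 3 * (size s + 2) ->
  [set u; last x s] \in A \/ k <= 2 * (size s + 2) ->
  m k + 2 <= #|edges G| + #|A|.
Proof.
move=> k_gt2 /andP[_ /forall_inP panG] Up Pp thin A2 ux_A long shortcut.
have [adj_uw adj_wx Ps] : [/\ adj G u w, adj G w x & path (adj G) x s].
  by case/and3P: Pp.
have [uNw uNx wNs] : [/\ u != w, u != x & w \notin x :: s].
  move: Up; rewrite !cons_uniq => /and3P[+ -> _].
  by rewrite !inE !negb_or => /and3P[].
apply: leq_trans (card_bypass A adj_uw adj_wx uNx); rewrite leq_add2r.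
set F := edges G :|: A.
have adjF : subrel (adj G) (edge_rel F).
  by move=> y z yz; apply/setUP; left.
apply: m_le_avoiding => // [e|l /andP[l_gt2 lek]].
  by rewrite inE => /orP[/card_edge|/A2].
have cycles j : 2 < j <= k.+1 ->
    (exists c, [/\ ucycle (adj G) c, w \notin c, size c = j
       & j + (size s).+1 <= k.+1])
    \/ exists r, [/\ path (adj G) (last x s) (rcons r u),
         uniq ([:: u, w, x & s] ++ r) & size s + size r + 3 = j].
  case/andP=> j_gt2 lejk.
  have /existsP[c Uc] := panG (Ordinal (n := k.+2) lejk) j_gt2.
  have sc : size c = j by rewrite size_tuple.
  have [wc|wNc] := boolP (w \in tval c); [right|left; exists c].
    have [|r [/andP[Cr Ur] sr]] := cycle_along_arc Uc _ Up Pp thin wc.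
      by rewrite sc.
    exists r; split; [|exact: Ur|].
      by move: Cr; rewrite /= rcons_cat cat_path => /and4P[].
    by rewrite -sc -sr /= size_cat addn3.
  split=> //; rewrite -sc; apply: cycle_off_arc_size Up Pp thin wNc => //.
  by rewrite sc.
have avoids q : uniq ([:: u, w, x & s] ++ q) -> w \notin q.
  rewrite cat_uniq => /and3P[_ /hasPn nq _].
  by apply/negP => /nq; rewrite !inE eqxx orbT.
have [big|small] := ltnP k (l + (size s).+1).
  (* The (l+1)-cycle is too long to avoid the arc; bypass [w] in it. *)
  have [|[c [_ _ _ off]]|[r [Pr Ur sr]]] := cycles l.+1.
  - by rewrite !ltnS lek ltnW.
  - by clear - big off; lia.
  exists [:: u, x & s ++ r]; split.
  - apply/andP; split.
      rewrite /= rcons_cat cat_path (sub_path adjF Ps) (sub_path adjF Pr).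
      by rewrite !andbT; apply/setUP; right.
    apply: subseq_uniq Ur.
    exact: (cat_subseq (subseq_refl [:: u]) (subseq_cons (x :: s ++ r) w)).
  - have /negPf wNr := avoids r Ur.
    move: wNs; rewrite !inE mem_cat wNr orbF !negb_or => ->.
    by rewrite eq_sym uNw.
  - by rewrite /= size_cat; clear - sr; lia.
have [|[c [/andP[Cc Uc] wNc sc _]]|[r [Pr Ur sr]]] := cycles l.
- by rewrite l_gt2 leqW.
- by exists c; split=> //; rewrite /ucycle Uc (sub_cycle adjF Cc).
have uv_F : edge_rel F u (last x s).
  apply/setUP; case: shortcut => [|half]; [by right | left].
  (* Here l = L + 1, so the cycle found is the arc closed by a chord. *)
  have r0 : r = [::] by apply: size0nil; clear - half small sr; lia.
  by move: Pr; rewrite r0 /= andbT adj_sym.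
(* A cycle long enough to contain the arc, in which that chord replaces it. *)
have [|[c [_ _ _ off]]|[r' [Pr' Ur' sr']]] := cycles (l + (size s).+1).
- by clear - l_gt2 small; lia.
- by clear - off sr long; lia.
have wNr' := avoids r' Ur'.
exists [:: u, last x s & r']; split.
- apply/andP; split; first by rewrite /= uv_F (sub_path adjF Pr').
  have v_sub : subseq [:: last x s] [:: w, x & s].
    by rewrite sub1seq inE mem_last orbT.
  apply: subseq_uniq Ur'.
  exact: (cat_subseq (cat_subseq (subseq_refl [:: u]) v_sub) (subseq_refl r')).
- rewrite !inE !negb_or wNr' eq_sym uNw andbT /=.
  by apply: contraNneq wNs => ->; rewrite mem_last.
- by rewrite /=; clear - sr'; lia.
Qed.

Theorem corollary2 (n : nat) (n_gt6 : 6 < n) :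
  ((exists (G : sgraph n) (H p : seq 'I_n),
      [/\ minimal_pancyclic G, hamiltonian G H, is_arc G H p
        & n - 1 <= 2 * path_length p]) ->
   m (n - 1) < m n)
  /\
  ((exists (G : sgraph n) (H p : seq 'I_n),
      [/\ minimal_pancyclic G, hamiltonian G H, is_arc G H p
        & n + 2 <= 3 * path_length p]) ->
   m (n - 1) <= m n).
Proof.
case: n n_gt6 => // k k_ge6; rewrite subn1 /=.
have arc_shape (G : sgraph k.+1) H p : hamiltonian G H -> is_arc G H p ->
    2 < size p -> exists u w x s, [/\ p = [:: u, w, x & s],
      uniq [:: u, w, x & s], path (adj G) u [:: w, x & s]
      & all (fun v => ~~ (2 < degree G v)) (belast w (x :: s))].
  move=> ham [/andP[inH thin] _] sp.
  have /andP[] := path_in_adj ham inH.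
  case: p sp thin {inH} => [|u [|w [|x s]]] // _ thin Pp Up.
  by exists u, w, x, s.
have pair2 (u w x : 'I_k.+1) s : uniq [:: u, w, x & s] ->
    #|[set u; x]| = 2 /\ #|[set u; last x s]| = 2.
  rewrite cons_uniq inE negb_or => /andP[/andP[_ uNs] _].
  by rewrite !cards2; split; congr (_.+1); apply/eqP; rewrite eqb1;
    apply: contraNneq uNs => ->; rewrite ?mem_head ?mem_last.
rewrite /path_length.
split=> -[G [H [p [[panG <-] ham arc len]]]].
- have [|u [w [x [s [Ep Up Pp thin]]]]] := arc_shape _ _ _ ham arc.
    by clear - k_ge6 len; lia.
  have [ux2 _] := pair2 _ _ _ _ Up; rewrite Ep /= in len.
  suff: m k + 2 <= #|edges G| + #|[set [set u; x]]|.
    by rewrite cards1 addn2 addn1 ltnS.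
  apply: (m_pred_arc _ panG Up Pp thin); rewrite ?set11 //.
  + by rewrite ltnW // ltnW // ltnW.
  + by move=> e /set1P->.
  + by clear - k_ge6 len; lia.
  + by right; clear - len; lia.
- have [|u [w [x [s [Ep Up Pp thin]]]]] := arc_shape _ _ _ ham arc.
    by clear - k_ge6 len; lia.
  have [ux2 uv2] := pair2 _ _ _ _ Up; rewrite Ep /= in len.
  set A := [set [set u; x]; [set u; last x s]].
  have le2 : #|A| <= 2 by rewrite cards2; case: (_ != _).
  have le_A : m k + 2 <= #|edges G| + #|A|.
    apply: (m_pred_arc _ panG Up Pp thin); rewrite ?set21 //.
    * by rewrite ltnW // ltnW // ltnW.
    * by move=> e /set2P[]->.
    * by clear - len; lia.
    * by left; rewrite set22.
  by rewrite -(leq_add2r 2) (leq_trans le_A) // leq_add2l.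
Qed.
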